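(* Let $C_{\mathrm{inv}}>0$ be the constant of the inverse inequality $\|v\|_{a(z_k)}\le C_{\mathrm{inv}}H^{-1}\|v\|$ for all $v\in V_{\mathrm{CEM}}$ and all $k$. Let $\{v_k^n\}\subset V_{\mathrm{POD}}^\ell$ ($0\le k\le K$, $0\le n\le N+1$) satisfy the fully discrete scheme: for all $k=1,\dots,K$, $n=1,\dots,N$ and all $w\in V_{\mathrm{POD}}^\ell$, $$\left(\frac{v_k^{n+1}-2v_k^n+v_k^{n-1}}{(\Delta t)^2},w;z_k\right)_c+\left(\frac{v_k^{n+1}-v_k^{n-1}}{2\tau},w\right)+\frac12 a(v_k^n,w;z_k)=\left(\frac{v_{k-1}^{n+1}-v_{k-1}^{n-1}}{2\tau},w\right),$$ where $\tau:=\Delta t\,\Delta z$. Suppose that the CFL condition $$\frac1{c_{\max}}-\frac14 C_{\mathrm{inv}}^2H^{-2}(\Delta t)^2\ge\delta$$ holds for some $\delta>0$. Then $$\frac1{4\tau}\sum_{n=1}^N\|v_K^{n+1}-v_K^{n-1}\|^2+\sum_{k=1}^K\mathcal E_{N,k}\le\frac1{4\tau}\sum_{n=1}^N\|v_0^{n+1}-v_0^{n-1}\|^2+\sum_{k=1}^K\mathcal E_{0,k},$$ where $$\mathcal E_{n,k}:=\left\|\frac{v_k^{n+1}-v_k^n}{\Delta t}\right\|_{c(z_k)}^2+\frac12a(v_k^{n+1},v_k^n;z_k).$$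
   Context: Setting. $\Omega\subset\mathbb R^2$ is a bounded domain, $D=[d_1,d_2]$, $T>0$, $V:=H_0^1(\Omega)$. The coefficient $c=c(z,x)$ is positive, in $L^\infty(D\times\Omega)$, bounded below by a positive constant; $c(z_k):=c(z_k,\cdot)$, $c_{\max}:=\|c\|_{L^\infty(D\times\Omega)}$. $\Delta z=(d_2-d_1)/K$, $z_k=d_1+k\Delta z$ ($k=0,\dots,K$), $\Delta t=T/N$; $v_k^n$ stands for the approximation at $z=z_k$, $t=n\Delta t$. Dots denote time derivatives. Notation: $(v,w;z_k)_c:=\int_\Omega c(z_k)^{-1}vw\,dx$, $(v,w):=\int_\Omega vw\,dx$, $a(v,w;z_k):=\int_\Omega c(z_k)\nabla v\cdot\nabla w\,dx$, with norms $\|v\|:=\sqrt{(v,v)}$, $\|v\|_{c(z_k)}:=\sqrt{(v,v;z_k)_c}$, $\|v\|_{a(z_k)}:=\sqrt{a(v,v;z_k)}$; $(u,v)_{H^1}:=(\nabla u,\nabla v)+(u,v)$. The multiscale space $V_{\mathrm{CEM}}$. Let $\mathcal T^H=\{K_i\}_{i=1}^{M}$ be a conforming partition of $\Omega$ (coarse grid) of mesh size $H$, with interior nodes $x_1,\dots,x_{N_c}$, and $\omega_j$ the union of the coarse elements having $x_j$ as a vertex. For each $k$ let $\{\chi_{j,k}^{\mathrm{ms}}\}_{j=1}^{N_c}$ be the associated multiscale partition of unity functions: $\chi_{j,k}^{\mathrm{ms}}$ satisfies $\nabla\cdot(c(z_k)\nabla\chi_{j,k}^{\mathrm{ms}})=0$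 in each coarse element contained in $\omega_j$, equals on the element boundaries inside $\omega_j$ a continuous function $g_j$ that is linear on edges, and vanishes on $\partial\omega_j$ (for the inverse inequality the paper takes $\{\chi_{j,k}^{\mathrm{ms}}\}_j$ to be a bilinear partition of unity). Put $\tilde\kappa(z_k):=\sum_{j=1}^{N_c}c(z_k)|\nabla\chi_{j,k}^{\mathrm{ms}}|^2$, $a_i(v,w;z_k):=\int_{K_i}c(z_k)\nabla v\cdot\nabla w\,dx$, $s_i(v,w;z_k):=\int_{K_i}\tilde\kappa(z_k)vw\,dx$, $s(\cdot,\cdot;z_k):=\sum_i s_i(\cdot,\cdot;z_k)$. Let $V(K_i)$ be the restriction of $V$ to $K_i$; let $(\sigma_j^{(i,k)},\phi_j^{(i,k)})$ be the eigenpairs of $a_i(\phi,v;z_k)=\sigma s_i(\phi,v;z_k)$ for all $v\in V(K_i)$, with eigenvalues in ascending order and $s_i(\phi_j^{(i,k)},\phi_j^{(i,k)};z_k)=1$. Keep the first $\ell_{i,k}\ge1$ eigenfunctions, and let $\pi_k(u):=\sum_i\sum_{j=1}^{\ell_{i,k}}s_i(u,\phi_j^{(i,k)};z_k)\phi_j^{(i,k)}$. For a fixed $m\in\mathbb N$, $K_i^+=K_{i,m}$ is the oversampling region obtained from $K_{i,0}=K_i$ by adding successively $m$ layers of neighbouring coarse elements, and $V_0(K_i^+)$ is the space of restrictions of functions of $V$ to $K_i^+$ with zero trace on $\partial K_i^+$ (extended by zero). The multiscale basis function $\psi_{j,\mathrm{ms}}^{(i,k)}\in V_0(K_i^+)$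 solves $a(\psi_{j,\mathrm{ms}}^{(i,k)},v;z_k)+s(\pi_k(\psi_{j,\mathrm{ms}}^{(i,k)}),\pi_k(v);z_k)=s(\phi_j^{(i,k)},v;z_k)$ for all $v\in V_0(K_i^+)$. Finally $V_{\mathrm{CEM}}:=\mathrm{span}\{\psi_{j,\mathrm{ms}}^{(i,k)}: 1\le i\le M,\ 1\le j\le\ell_{i,k},\ 0\le k\le K\}$, a finite-dimensional subspace of $V$. The space $V_{\mathrm{POD}}^\ell$. Let $v_{\mathrm{CEM},k}:[0,T]\to V_{\mathrm{CEM}}$, $k=0,\dots,K$, solve $(\ddot v_{\mathrm{CEM},k},w;z_k)_c+\frac1{\Delta z}(\dot v_{\mathrm{CEM},k}-\dot v_{\mathrm{CEM},k-1},w)+\frac12a(v_{\mathrm{CEM},k},w;z_k)=0$ for all $w\in V_{\mathrm{CEM}}$, $k=1,\dots,K$ (with given layer $k=0$ and initial data). The snapshots are the $3K+2$ functions $y_j:=v_{\mathrm{CEM},j-1}$, $y_{j+K+1}:=\ddot v_{\mathrm{CEM},j-1}$ ($1\le j\le K+1$), $y_{j+2K+2}:=(\dot v_{\mathrm{CEM},j}-\dot v_{\mathrm{CEM},j-1})/\Delta z$ ($1\le j\le K$). Let $\psi_1,\dots,\psi_{\mathcal N}\in V_{\mathrm{CEM}}$ be the corresponding POD basis: $H^1$-orthonormal eigenvectors for the positive eigenvalues $\lambda_1\ge\dots\ge\lambda_{\mathcal N}>0$ of $v\mapsto\frac1{3K+2}\sum_{j=1}^{3K+2}\int_0^T(v,y_j(t))_{H^1}\,y_j(t)\,dt$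 on $V_{\mathrm{CEM}}$. Then $V_{\mathrm{POD}}^\ell:=\mathrm{span}\{\psi_1,\dots,\psi_\ell\}\subset V_{\mathrm{CEM}}$, $1\le\ell\le\mathcal N$. *)

(* Defs.v *)
From HB Require Import structures.
From mathcomp Require Import all_boot all_order all_algebra.
From mathcomp Require Import all_classical all_reals all_analysis.

Set Implicit Arguments.
Unset Strict Implicit.
Unset Printing Implicit Defensive.

Import Order.TTheory GRing.Theory Num.Theory.
Import numFieldNormedType.Exports.
Local Open Scope classical_set_scope.
Local Open Scope ring_scope.

(* The plane. measurableTypeR R is R with its Borel sets, the domain of the
   library's lebesgue_measure; order, algebra and topology are those of R. *)
Definition pt (R : realType) : Type :=
  (measurableTypeR R * measurableTypeR R)%type.

Definition mu2 (R : realType) : {measure set (pt R) -> \bar R} :=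
  (@lebesgue_measure R \x @lebesgue_measure R)%E.

Definition mu3 (R : realType) : {measure set (pt R * measurableTypeR R) -> \bar R} :=
  (mu2 R \x @lebesgue_measure R)%E.

(* An element of a first-order Sobolev space, carried together with its weak
   gradient: (u, (d_1 u, d_2 u)). All three are actual functions on the plane;
   identification almost everywhere is explicit, see [aeeq]. *)
Definition h1 (R : realType) : Type :=
  ((pt R -> R) * ((pt R -> R) * (pt R -> R)))%type.

Section Sobolev.
Context {R : realType}.
Implicit Types (U S : set (pt R)) (u v w : h1 R) (k : pt R -> R).

Definition dir (d : bool) : pt R := if d then (0, 1) else (1, 0).

Fixpoint iter_partial (s : seq bool) (f : pt R -> R) : pt R -> R :=
  if s is d :: s' then 'D_(dir d) (iter_partial s' f) else f.

Definition smooth (f : pt R -> R) : Prop :=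
  forall s : seq bool, continuous (iter_partial s f) /\
    forall (d : bool) (x : pt R), derivable (iter_partial s f) x (dir d).

(* C_c^oo(U), extended by zero *)
Definition test_fun U (f : pt R -> R) : Prop :=
  smooth f /\
  exists2 A : set (pt R), compact A /\ A `<=` U & forall x, ~ A x -> f x = 0.

Definition L2_cvg (f_ : nat -> pt R -> R) (f : pt R -> R) : Prop :=
  (fun n => (\int[mu2 R]_x ((f_ n x - f x) ^+ 2)%:E)%E) @ \oo --> 0%E.

(* H^1_0(U), the closure of C_c^oo(U) for the H^1 norm; its elements are
   extended by zero outside U. The last two components of u are then the weak
   partial derivatives of the first, and are determined by it a.e. *)
Definition H10 U : set (h1 R) := [set u |
  [/\ u.1 \in Lfun (mu2 R) 2%:E,
      u.2.1 \in Lfun (mu2 R) 2%:E,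
      u.2.2 \in Lfun (mu2 R) 2%:E,
      forall x, ~ U x -> [/\ u.1 x = 0, u.2.1 x = 0 & u.2.2 x = 0]
    & exists phi : nat -> pt R -> R,
      [/\ forall n, test_fun U (phi n),
          L2_cvg phi u.1,
          L2_cvg (fun n => 'D_(dir false) (phi n)) u.2.1
        & L2_cvg (fun n => 'D_(dir true) (phi n)) u.2.2]]].

Definition aeeq u v : Prop :=
  {ae mu2 R, forall x, [/\ u.1 x = v.1 x, u.2.1 x = v.2.1 x & u.2.2 x = v.2.2 x]}.

(* The linear span of B among the elements of V, modulo a.e. equality. *)
Definition span_in (V B : set (h1 R)) : set (h1 R) := [set u | V u /\
  exists n (a : 'I_n -> R) (b : 'I_n -> h1 R),
    (forall i, B (b i)) /\ aeeq u (\sum_(i < n) a i *: b i)].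

Definition restr S u : h1 R := (u.1 \_ S, (u.2.1 \_ S, u.2.2 \_ S)).

Definition grad_dot u v (x : pt R) : R := u.2.1 x * v.2.1 x + u.2.2 x * v.2.2 x.

Definition form_L2 S u v : R := \int[mu2 R]_(x in S) (u.1 x * v.1 x).
Definition form_c k S u v : R := \int[mu2 R]_(x in S) ((k x)^-1 * u.1 x * v.1 x).
Definition form_a k S u v : R := \int[mu2 R]_(x in S) (k x * grad_dot u v x).
Definition form_s k S (f g : pt R -> R) : R := \int[mu2 R]_(x in S) (k x * f x * g x).
Definition form_H1 S u v : R :=
  \int[mu2 R]_(x in S) grad_dot u v x + form_L2 S u v.

Definition norm_L2 S u : R := Num.sqrt (form_L2 S u u).
Definition norm_c k S u : R := Num.sqrt (form_c k S u u).
Definition norm_a k S u : R := Num.sqrt (form_a k S u u).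
Definition norm_H1 S u : R := Num.sqrt (form_H1 S u u).

End Sobolev.

Section Coefficient.
Context {R : realType}.
Variables (Omega : set (pt R)) (d1 d2 : R) (c : R -> pt R -> R).

Definition coef_norm : \bar R :=
  ('N[mu3 R]_+oo [EFin \o ((fun p => c p.2 p.1) \_ (Omega `*` `[d1, d2]))])%E.

Definition c_max : R := fine coef_norm.

(* The scheme evaluates c at the single depths z_k, which an L^oo class on
   D x Omega does not see: the bounds are therefore required a.e. in x for
   every z of D. *)
Record admissible_coef : Prop := {
  coef_meas : measurable_fun
    (Omega `*` `[d1, d2] : set (pt R * measurableTypeR R)) (fun p => c p.2 p.1);
  coef_Linfty : (coef_norm < +oo)%E;
  coef_bounds : exists2 c0 : R, 0 < c0 & forall z, z \in `[d1, d2] ->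
    {ae mu2 R, forall x, Omega x -> c0 <= c z x <= c_max} }.

End Coefficient.

Section Mesh.
Context {R : realType}.
Implicit Types (p : seq (pt R)) (a b x : pt R).

Definition seg a b : set (pt R) :=
  [set x | exists2 t : R, 0 <= t <= 1 & x = (1 - t) *: a + t *: b].

Definition edges p : seq (pt R * pt R) := zip p (rot 1 p).

(* E is the closed region bounded by the simple closed polygonal line p. *)
Record polygon p (E : set (pt R)) : Prop := {
  polygon_size : (2 < size p)%N;
  polygon_uniq : uniq p;
  polygon_compact : compact E;
  polygon_conn : connected E°;
  polygon_inner : E° !=set0;
  polygon_reg : closure E° = E;
  polygon_boundary :
    E `\` E° = [set x | exists2 e, e \in edges p & seg e.1 e.2 x];
  polygon_simple : forall e e' x, e \in edges p -> e' \in edges p -> e <> e' ->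
    seg e.1 e.2 x -> seg e'.1 e'.2 x ->
    x \in [:: e.1; e.2] /\ x \in [:: e'.1; e'.2] }.

Record coarse_grid (Omega : set (pt R)) : Type := CoarseGrid {
  num_elt : nat;
  vtx : 'I_num_elt -> seq (pt R);
  elt : 'I_num_elt -> set (pt R);
  num_node : nat;
  node : 'I_num_node -> pt R;
  elt_polygon : forall i, polygon (vtx i) (elt i);
  elt_inner : forall i, (elt i)° `<=` Omega;
  elt_cover : closure Omega = \bigcup_i elt i;
  elt_conforming : forall i j x, i <> j -> elt i x -> elt j x ->
    (x \in vtx i /\ x \in vtx j) \/
    exists e e', [/\ e \in edges (vtx i), e' \in edges (vtx j),
      seg e.1 e.2 = seg e'.1 e'.2 & seg e.1 e.2 x];
  node_inj : injective node;
  node_interior : range node = [set x | Omega x /\ exists i, x \in vtx i] }.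

End Mesh.

Arguments vtx {R Omega} G i : rename.
Arguments elt {R Omega} G i : rename.
Arguments node {R Omega} G j : rename.

Section Grid.
Context {R : realType} {Omega : set (pt R)}.
Variable G : coarse_grid Omega.

Definition dist2 (x y : pt R) : R :=
  Num.sqrt ((x.1 - y.1 : R) ^+ 2 + (x.2 - y.2 : R) ^+ 2).

Definition mesh_size : R :=
  sup [set h | exists i (x y : pt R), [/\ elt G i x, elt G i y & h = dist2 x y]].

Definition omega (j : 'I_(num_node G)) : set (pt R) :=
  [set x | exists2 i, node G j \in vtx G i & elt G i x].

(* the oversampling region K_{i,m} *)
Fixpoint oversample (i : 'I_(num_elt G)) (m : nat) : set (pt R) :=
  if m is m'.+1 then
    \bigcup_(j in [set j | elt G j `&` oversample i m' !=set0]) elt G j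
  else elt G i.

(* V_0(K_{i,m}) *)
Definition V0 (i : 'I_(num_elt G)) (m : nat) : set (h1 R) :=
  H10 ((oversample i m)° `&` Omega).

(* V(K_i), the restrictions being extended by zero *)
Definition V_elt (i : 'I_(num_elt G)) : set (h1 R) := restr (elt G i) @` H10 Omega.

Definition skeleton (j : 'I_(num_node G)) : set (pt R) :=
  [set x | exists i, node G j \in vtx G i /\ (elt G i `\` (elt G i)°) x].

(* the boundary data g_j of the partition of unity function of the node x_j *)
Record pou_trace (j : 'I_(num_node G)) (g : pt R -> R) : Prop := {
  trace_cont : {within skeleton j, continuous g};
  trace_lin : forall i e t, node G j \in vtx G i -> e \in edges (vtx G i) ->
    0 <= t <= 1 ->
    g ((1 - t) *: e.1 + t *: e.2) = (1 - t) * g e.1 + t * g e.2;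
  trace_vtx : forall i x, node G j \in vtx G i -> x \in vtx G i ->
    g x = (x == node G j)%:R;
  trace_bnd : forall x, skeleton j x -> ~ (omega j)° x -> g x = 0 }.

(* The solution of the local problem is continuous up to the element
   boundaries, so its trace is read off its continuous representative. *)
Record ms_pou (k : pt R -> R) (j : 'I_(num_node G)) (g : pt R -> R)
    (chi : h1 R) : Prop := {
  ms_V : H10 Omega chi;
  ms_cont : continuous chi.1;
  ms_supp : forall x, ~ (omega j)° x -> chi.1 x = 0;
  ms_trace : forall x, skeleton j x -> chi.1 x = g x;
  ms_harmonic : forall i f, node G j \in vtx G i -> test_fun (elt G i)° f ->
    \int[mu2 R]_(x in elt G i)
      (k x * (chi.2.1 x * 'D_(dir false) f x + chi.2.2 x * 'D_(dir true) f x)) = 0 }.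

Definition bilinear (V : lmodType R) (s t : R) (a0 a1 a2 a3 : V) : V :=
  ((1 - s) * (1 - t)) *: a0 + (s * (1 - t)) *: a1 + (s * t) *: a2
  + ((1 - s) * t) *: a3.

(* The bilinear alternative, on quadrilateral elements: the isoparametric
   bilinear nodal functions. *)
Record bilinear_pou (j : 'I_(num_node G)) (chi : h1 R) : Prop := {
  bil_V : H10 Omega chi;
  bil_elt : forall i, exists p0 p1 p2 p3, vtx G i = [:: p0; p1; p2; p3] /\
    forall s t, 0 <= s <= 1 -> 0 <= t <= 1 ->
      let hat p : R := (p == node G j)%:R in
      chi.1 (bilinear s t p0 p1 p2 p3) =
        bilinear s t (hat p0) (hat p1) (hat p2) (hat p3) }.

Definition kappa_tilde (k : pt R -> R) (chi : 'I_(num_node G) -> h1 R)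
    (x : pt R) : R :=
  \sum_j k x * grad_dot (chi j) (chi j) x.

(* All the eigenpairs of the local spectral problem, counted with multiplicity
   and in ascending order. *)
Record eigenpairs (k kt : pt R -> R) (i : 'I_(num_elt G))
    (sigma : nat -> R) (phi : nat -> h1 R) : Prop := {
  eig_in : forall j, V_elt i (phi j);
  eig_eq : forall j v, V_elt i v ->
    form_a k (elt G i) (phi j) v = sigma j * form_s kt (elt G i) (phi j).1 v.1;
  eig_unit : forall j, form_s kt (elt G i) (phi j).1 (phi j).1 = 1;
  eig_asc : forall j j', (j <= j')%N -> sigma j <= sigma j';
  eig_free : forall n (a : 'I_n -> R),
    aeeq (\sum_(j < n) a j *: phi j) 0 -> forall j, a j = 0;
  eig_all : forall s w, V_elt i w ->
    (forall v, V_elt i v ->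
       form_a k (elt G i) w v = s * form_s kt (elt G i) w.1 v.1) ->
    span_in (V_elt i) (range phi) w }.

Definition proj_aux (kt : pt R -> R) (phi : 'I_(num_elt G) -> nat -> h1 R)
    (l : 'I_(num_elt G) -> nat) (f : pt R -> R) (x : pt R) : R :=
  \sum_i \sum_(j < l i) form_s kt (elt G i) f (phi i j).1 * (phi i j).1 x.

Definition form_s_grid (kt : pt R -> R) (f g : pt R -> R) : R :=
  \sum_i form_s kt (elt G i) f g.

Definition ms_basis (k kt : pt R -> R) (phi : 'I_(num_elt G) -> nat -> h1 R)
    (l : 'I_(num_elt G) -> nat) (m : nat) (i : 'I_(num_elt G)) (j : nat)
    (psi : h1 R) : Prop :=
  V0 i m psi /\
  forall v, V0 i m v ->
    form_a k Omega psi v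
      + form_s_grid kt (proj_aux kt phi l psi.1) (proj_aux kt phi l v.1)
    = form_s_grid kt (phi i j).1 v.1.

(* VCEM is the multiscale space built on the coefficients ck 0, ..., ck K,
   with m oversampling layers. *)
Definition is_CEM_space (K : nat) (ck : nat -> pt R -> R) (m : nat)
    (VCEM : set (h1 R)) : Prop :=
  exists (chi : nat -> 'I_(num_node G) -> h1 R)
    (sigma : nat -> 'I_(num_elt G) -> nat -> R)
    (phi : nat -> 'I_(num_elt G) -> nat -> h1 R)
    (l : nat -> 'I_(num_elt G) -> nat)
    (psi : nat -> 'I_(num_elt G) -> nat -> h1 R),
    let kt k := kappa_tilde (ck k) (chi k) in
    [/\ (exists2 g : 'I_(num_node G) -> pt R -> R,
           forall j, pou_trace j (g j) &
           forall k j, (k <= K)%N -> ms_pou (ck k) j (g j) (chi k j)) \/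
        (forall k j, (k <= K)%N -> bilinear_pou j (chi k j)),
        forall k i, (k <= K)%N -> eigenpairs (ck k) (kt k) i (sigma k i) (phi k i),
        forall k i, (k <= K)%N -> (1 <= l k i)%N,
        forall k i j, (k <= K)%N -> (j < l k i)%N ->
          ms_basis (ck k) (kt k) (phi k) (l k) m i j (psi k i j)
      & VCEM = span_in (H10 Omega) [set u | exists k i j,
          [/\ (k <= K)%N, (j < l k i)%N & u = psi k i j]]].

End Grid.

Section POD.
Context {R : realType}.
Variables (Omega : set (pt R)) (W : set (h1 R)) (T : R).
Implicit Types (f : R -> h1 R).

Definition time_derivative f f' : Prop := forall t, t \in `[0, T] ->
  norm_H1 Omega ((s - t)^-1 *: (f s - f t) - f' t)
    @[s --> within `[0, T] (dnbhs t)] --> (0 : R).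

Definition time_continuous f : Prop := forall t, t \in `[0, T] ->
  norm_H1 Omega (f s - f t) @[s --> within `[0, T] (nbhs t)] --> (0 : R).

(* y is the integral over [0, T] of the W-valued function f, W being a
   finite-dimensional space with the H^1 inner product. *)
Definition time_integral f (y : h1 R) : Prop :=
  W y /\ forall w, W w ->
    form_H1 Omega y w =
      \int[@lebesgue_measure R]_(t in `[0, T]) form_H1 Omega (f t) w.

(* The layers v k : [0, T] -> V_CEM with their first and second time
   derivatives v' k and v'' k. *)
Record semidiscrete_solution (K : nat) (ck : nat -> pt R -> R) (dz : R)
    (v v' v'' : nat -> R -> h1 R) : Prop := {
  sd_in : forall k t, (k <= K)%N -> t \in `[0, T] ->
    [/\ W (v k t), W (v' k t) & W (v'' k t)];
  sd_d1 : forall k, (k <= K)%N -> time_derivative (v k) (v' k);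
  sd_d2 : forall k, (k <= K)%N -> time_derivative (v' k) (v'' k);
  sd_cont : forall k, (k <= K)%N -> time_continuous (v'' k);
  sd_eq : forall k t w, (1 <= k <= K)%N -> t \in `[0, T] -> W w ->
    form_c (ck k) Omega (v'' k t) w
      + dz^-1 * form_L2 Omega (v' k t - v' k.-1 t) w
      + 2^-1 * form_a (ck k) Omega (v k t) w = 0 }.

(* the snapshots y_r, numbered 1 <= r <= 3K + 2 *)
Definition snapshot (K : nat) (dz : R) (v v' v'' : nat -> R -> h1 R)
    (r : nat) (t : R) : h1 R :=
  if (r <= K.+1)%N then v r.-1 t
  else if (r <= 2 * K + 2)%N then v'' (r - K.+1).-1 t
  else dz^-1 *: (v' (r - (2 * K + 2))%N t - v' (r - (2 * K + 2)).-1 t).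

(* u is the image of v under the POD operator of the snapshots y_1, ..., y_M *)
Definition pod_image (M : nat) (y : nat -> R -> h1 R) (v u : h1 R) : Prop :=
  exists z : nat -> h1 R,
    (forall r, (1 <= r <= M)%N ->
       time_integral (fun t => form_H1 Omega v (y r t) *: y r t) (z r)) /\
    aeeq u (M%:R^-1 *: \sum_(1 <= r < M.+1) z r).

(* lam and psi list all positive eigenvalues, with multiplicity, and the
   associated orthonormal eigenvectors. *)
Record pod_basis (M : nat) (y : nat -> R -> h1 R) (NN : nat)
    (lam : 'I_NN -> R) (psi : 'I_NN -> h1 R) : Prop := {
  pod_in : forall i, W (psi i);
  pod_pos : forall i, 0 < lam i;
  pod_desc : forall i j : 'I_NN, (i <= j)%N -> lam j <= lam i;
  pod_orth : forall i j, form_H1 Omega (psi i) (psi j) = (i == j)%:R;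
  pod_eig : forall i, pod_image M y (psi i) (lam i *: psi i);
  pod_all : forall s w, 0 < s -> W w -> pod_image M y w (s *: w) ->
    span_in W (range psi) w }.

(* VPOD is the span of the first l elements of a POD basis of the snapshots of
   a semidiscrete solution with values in W. *)
Definition is_POD_space (K : nat) (ck : nat -> pt R -> R) (dz : R) (l : nat)
    (VPOD : set (h1 R)) : Prop :=
  exists (v v' v'' : nat -> R -> h1 R) (NN : nat)
    (lam : 'I_NN -> R) (psi : 'I_NN -> h1 R),
    [/\ semidiscrete_solution K ck dz v v' v'',
        pod_basis (3 * K + 2) (snapshot K dz v v' v'') lam psi,
        (1 <= l <= NN)%N
      & VPOD = span_in (H10 Omega) [set u | exists2 i : 'I_NN, (i < l)%N & u = psi i]].

End POD.

Definition energy {R : realType} (Omega : set (pt R)) (k : pt R -> R) (dt : R)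
    (v : nat -> h1 R) (n : nat) : R :=
  norm_c k Omega (dt^-1 *: (v n.+1 - v n)) ^+ 2
  + 2^-1 * form_a k Omega (v n.+1) (v n).

(* Main.v *)
Require Import Defs.
From mathcomp Require Import all_boot all_order all_algebra.
From mathcomp Require Import ring lra.
From mathcomp Require Import all_classical all_reals all_analysis.
From mathcomp Require Import measurable_realfun.
Import Order.TTheory GRing.Theory Num.Theory.
Import numFieldNormedType.Exports.
Local Open Scope classical_set_scope.
Local Open Scope ring_scope.

(** The estimate is the discrete energy identity of the leapfrog scheme.
    Fix a layer k >= 1 and a time index n >= 1, and test the scheme with
    w_k = v_k^{n+1} - v_k^{n-1}. Since w_k is the sum of the forward and the
    backward difference of v_k at n, whose difference is the second difference,
    the inertial term is the increment of the squared discrete velocity; and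
    a(v_k^n, w_k) is the increment of a(v_k^{n+1}, v_k^n) by symmetry. Hence
      E_{n,k} - E_{n-1,k} + 1/(2 tau) |w_k|^2 = 1/(2 tau) (w_{k-1}, w_k),
    and (w_{k-1}, w_k) <= (|w_{k-1}|^2 + |w_k|^2) / 2 turns this into
      E_{n,k} + 1/(4 tau) |w_k|^2 <= E_{n-1,k} + 1/(4 tau) |w_{k-1}|^2,
    which is [leapfrog_energy_step]. Energies telescope in time and fluxes in
    depth, so that summing over n and k gives the claim
    ([telescope_energy_flux]).

    The step only uses that the three forms are symmetric and bilinear and that
    the L^2 form is nonnegative. As integrals are total functions here,
    bilinearity is a statement about integrability: the components of an
    element of H^1_0 are square integrable, so their products are integrable,
    and remain so against a weight that is measurable and essentially bounded
    on Omega ([integrable_weight]). Both c(z) and 1/c(z) are such weights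
    ([weight_coef]), since c is measurable on the product of Omega and the
    depth range and lies between two positive constants almost everywhere at
    each depth. *)

Set Implicit Arguments.
Unset Strict Implicit.

(** * The discrete energy estimate *)

(** Linearity is asked only on [P] because the integral forms are linear only
    where the integrands are integrable. *)
Record symmetric_bilinear_on (R : realFieldType) (V : lmodType R) (P : set V)
    (B : V -> V -> R) : Prop := {
  form_sym : forall u v, P u -> P v -> B u v = B v u;
  form_lin : forall a u v w, P u -> P v -> P w ->
    B (a *: u + v) w = a * B u w + B v w }.

Section Leapfrog.
Context {R : realFieldType} {V : lmodType R} (P : set V).
Hypothesis P_lin : forall a u v, P u -> P v -> P (a *: u + v).

Lemma subspaceZ a u : P u -> P (a *: u).
Proof.
by move=> Pu; rewrite -[a](subrK 1) scalerDl scale1r; exact: P_lin.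
Qed.

Lemma subspaceD u v : P u -> P v -> P (u + v).
Proof. by move=> Pu Pv; rewrite -[u]scale1r; exact: P_lin. Qed.

Lemma subspaceB u v : P u -> P v -> P (u - v).
Proof. by move=> Pu Pv; rewrite addrC -scaleN1r; exact: P_lin. Qed.

Section BilinearForm.
Context {B : V -> V -> R}.
Hypothesis B_form : symmetric_bilinear_on P B.

Lemma formDl u v w : P u -> P v -> P w -> B (u + v) w = B u w + B v w.
Proof.
by move=> Pu Pv Pw; rewrite -{1}[u]scale1r (form_lin B_form)// mul1r.
Qed.

Lemma formZl a u w : P u -> P w -> B (a *: u) w = a * B u w.
Proof.
move=> Pu Pw; rewrite -{1}[a](subrK 1) scalerDl scale1r (form_lin B_form)//.
by rewrite mulrBl mul1r subrK.
Qed.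

Lemma formBl u v w : P u -> P v -> P w -> B (u - v) w = B u w - B v w.
Proof.
by move=> *; rewrite addrC -scaleN1r (form_lin B_form)// mulN1r addrC.
Qed.

Lemma formBr u v w : P u -> P v -> P w -> B w (u - v) = B w u - B w v.
Proof.
move=> Pu Pv Pw; have Puv := subspaceB Pu Pv.
by rewrite !(form_sym B_form Pw)// formBl.
Qed.

Lemma form_sqrB u v : P u -> P v ->
  B (u - v) (u - v) = B u u - 2 * B u v + B v v.
Proof.
move=> Pu Pv; have Puv := subspaceB Pu Pv.
rewrite formBr// !formBl//.
by rewrite (form_sym B_form Pv Pu); ring.
Qed.

Lemma form_sqrZ a u : P u -> B (a *: u) (a *: u) = a ^+ 2 * B u u.
Proof.
move=> Pu; have Pau := subspaceZ a Pu.
by rewrite formZl// (form_sym B_form)// formZl// mulrA.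
Qed.

End BilinearForm.

(** With p0, p1, p2 three consecutive time levels of one layer and q0, q2 the
    outer levels of the previous layer, this is the energy inequality for one
    time step. Testing with p2 and with p0, rather than with p2 - p0, asks
    nothing of the trial space beyond containing the two; the identity for
    their difference follows from bilinearity. *)
Lemma leapfrog_energy_step (mc b a : V -> V -> R) (dt tau : R) (p0 p1 p2 q0 q2 : V) :
  symmetric_bilinear_on P mc -> symmetric_bilinear_on P b ->
  symmetric_bilinear_on P a -> (forall u, P u -> 0 <= b u u) ->
  0 < tau ->
  P p0 -> P p1 -> P p2 -> P q0 -> P q2 ->
  (forall w, w \in [:: p2; p0] ->
     mc ((dt ^+ 2)^-1 *: (p2 - 2 *: p1 + p0)) w
     + b ((2 * tau)^-1 *: (p2 - p0)) w + 2^-1 * a p1 w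
     = b ((2 * tau)^-1 *: (q2 - q0)) w) ->
  mc (dt^-1 *: (p2 - p1)) (dt^-1 *: (p2 - p1)) + 2^-1 * a p2 p1
    + (4 * tau)^-1 * b (p2 - p0) (p2 - p0)
  <= mc (dt^-1 *: (p1 - p0)) (dt^-1 *: (p1 - p0)) + 2^-1 * a p1 p0
    + (4 * tau)^-1 * b (q2 - q0) (q2 - q0).
Proof.
move=> Hmc Hb Ha b_ge0 tau_gt0 P0 P1 P2 Q0 Q2 scheme.
have {}scheme w : P w -> w \in [:: p2; p0] ->
    dt^-1 ^+ 2 * (mc p2 w - 2 * mc p1 w + mc p0 w)
    + (2 * tau)^-1 * b (p2 - p0) w + 2^-1 * a p1 w
    = (2 * tau)^-1 * b (q2 - q0) w.
  move=> Pw /scheme; have P21 := subspaceZ 2 P1.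
  have PB := subspaceB P2 P21; have PBD := subspaceD PB P0.
  rewrite (formZl Hmc)// (formDl Hmc)// (formBl Hmc)// (formZl Hmc)// -exprVn.
  by rewrite !(formZl Hb)//; exact: subspaceB.
have := scheme p2 P2; have := scheme p0 P0; rewrite !inE !eqxx orbT.
move=> /(_ isT) at_p0 /(_ isT) at_p2.
have Pp := subspaceB P2 P0; have Pq := subspaceB Q2 Q0.
(* Young's inequality for the coupling term, as the square of
   (p2 - p0) - (q2 - q0). *)
have young : 0 <= b (p2 - p0) (p2 - p0) - 2 * b (q2 - q0) (p2 - p0)
                  + b (q2 - q0) (q2 - q0).
  by rewrite (form_sym Hb Pq Pp) -form_sqrB//; apply: b_ge0; exact: subspaceB.
have b_p := formBr Hb P2 P0 Pp.
have b_q := formBr Hb P2 P0 Pq.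
rewrite !(form_sqrZ Hmc) ?(form_sqrB Hmc)//; try exact: subspaceB.
move: at_p0 at_p2; rewrite (form_sym Ha P2 P1).
rewrite (form_sym Hmc P1 P0) (form_sym Hmc P1 P2) (form_sym Hmc P0 P2).
have -> : (2 * tau)^-1 = 2 * (4 * tau)^-1 by field; rewrite gt_eqF.
have : 0 <= (4 * tau)^-1 * (b (p2 - p0) (p2 - p0) - 2 * b (q2 - q0) (p2 - p0)
                  + b (q2 - q0) (q2 - q0)).
  by rewrite mulr_ge0// invr_ge0 mulr_ge0// ltW.
rewrite b_q b_p; lra.
Qed.

End Leapfrog.

(** In a discrete conservation inequality on a K x N grid the energies [E]
    cancel along time and the fluxes [A] cancel along depth, which leaves the
    final energies and the outgoing flux bounded by the initial energies and
    the incoming flux. *)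
Lemma telescope_energy_flux (R : realFieldType) (r : R)
    (E A : nat -> nat -> R) (K N : nat) :
  (forall k n, (k < K)%N -> (n < N)%N ->
     E k.+1 n.+1 + r * A k.+1 n.+1 <= E k.+1 n + r * A k n.+1) ->
  r * \sum_(1 <= n < N.+1) A K n + \sum_(1 <= k < K.+1) E k N
  <= r * \sum_(1 <= n < N.+1) A 0%N n + \sum_(1 <= k < K.+1) E k 0%N.
Proof.
move=> step.
have layer k : (k < K)%N ->
    r * \sum_(1 <= n < N.+1) A k.+1 n + E k.+1 N
    <= r * \sum_(1 <= n < N.+1) A k n + E k.+1 0%N.
  move=> kK; elim: N step => [|N' IH] step; first by rewrite !big_geq.
  have {}IH := IH (fun k n kK nN => step k n kK (ltnW nN)).
  have stepN := step k N' kK (ltnSn _).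
  rewrite !(@big_nat_recr _ _ _ N'.+1)//= !mulrDr.
  by have := lerD IH stepN; lra.
elim: K {step} layer => [|K' IH] layer.
  by rewrite [\sum_(1 <= k < 1) E k N]big_geq// [\sum_(1 <= k < 1) E k 0%N]big_geq.
have {}IH := IH (fun k kK => layer k (ltnW kK)).
have layerK := layer K' (ltnSn _).
rewrite ![\sum_(1 <= k < K'.+2) _](@big_nat_recr _ _ _ K'.+1)//=.
by have := lerD IH layerK; lra.
Qed.

(** * Measurability *)

(** The plane carries the product sigma-algebra, whereas openness refers to
    the product topology; the two agree because an open set is the union of
    the countably many boxes with rational centre and radius inside it. *)
Lemma open_measurable_plane (R : realType) (U : set (pt R)) :
  open U -> measurable U.
Proof.
move=> oU.
pose box (q : (rat * rat) * rat) : set (pt R) :=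
  ball (ratr q.1.1 : R) (ratr q.2) `*` ball (ratr q.1.2 : R) (ratr q.2).
have -> : U = \bigcup_q (if `[< box q `<=` U >] then box q else set0).
  apply/seteqP; split => [[x y] Uxy|xy [q _]]; last first.
    by case: ifPn => // /asboolP; exact.
  have /nbhs_ballP[e /= e0 exyU] : nbhs ((x, y) : pt R) U by exact: open_nbhs_nbhs.
  have [r /itvP r0e] : exists r, ratr r \in `]0, (e / 2)[%R.
    by apply: rat_in_itvoo; rewrite divr_gt0.
  have rat_near (z : R) : exists q, ball (ratr q : R) (ratr r) z.
    have [q qz] : exists q, ratr q \in `](z - ratr r), (z + ratr r)[%R.
      by apply: rat_in_itvoo; rewrite ltrD2l (@lt_trans _ _ 0)// ?oppr_lt0 r0e.
    exists q; rewrite /ball/= ltr_distlC; move: qz; rewrite in_itv/= => /andP[? ?].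
    by apply/andP; split; lra.
  have [p px] := rat_near x; have [q qy] := rat_near y.
  exists (p, q, r) => //=; rewrite ifT//; apply/asboolP => -[x' y'] [/= px' qy'].
  have re : ratr r + ratr r <= e :> R.
    by have : ratr r < e / 2 :> R by [rewrite r0e]; lra.
  apply: exyU; split => /=; apply: (le_ball re).
    by apply: ball_triangle px'; exact: ball_sym.
  by apply: ball_triangle qy'; exact: ball_sym.
apply: countable_bigcupT_measurable => // q; case: ifPn => // _.
by apply: measurableX; apply: open_measurable; exact: ball_open.
Qed.

(** Inversion is continuous off 0, and {0} is a measurable singleton. *)
Lemma measurable_inv (R : realType) : measurable_fun [set: R] (@GRing.inv R).
Proof.
rewrite -(setUv [set 0 : R]).
apply/measurable_funU => //; first exact: measurableC.
split; first exact: measurable_fun_set1.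
apply: open_continuous_measurable_fun.
  by apply: closed_openC; exact: closed_eq.
by move=> x; rewrite inE => /eqP x0; exact: inv_continuous.
Qed.

(** The coefficient is measurable jointly in position and depth; the scheme
    uses its slices at single depths. *)
Lemma measurable_coef_section (R : realType) (Omega : set (pt R)) (d1 d2 z : R)
    (c : R -> pt R -> R) :
  open Omega -> admissible_coef Omega d1 d2 c -> z \in `[d1, d2] ->
  measurable_fun Omega (c z).
Proof.
move=> /open_measurable_plane mO cadm zD.
have mOD : measurable (Omega `*` `[d1, d2] : set (pt R * measurableTypeR R)).
  exact: measurableX.
apply: (measurable_comp (g := fun x : pt R => (x, z : measurableTypeR R))
  mOD _ (coef_meas cadm)) => [xz [x Ox <-]|] //=.
exact: measurable_funS (@measurableT _ _) _ (pair2_measurable _).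
Qed.

(** * Weighted integrals of products of square-integrable functions *)

Section WeightedForms.
Context {R : realType} (S : set (pt R)).
Hypothesis mS : measurable S.

(** The bounds hold almost everywhere because the coefficient is controlled
    only up to null sets. *)
Record bounded_weight (k : pt R -> R) : Prop := {
  weight_meas : measurable_fun S k;
  weight_bound : exists M : R, {ae mu2 R, forall x, S x -> 0 <= k x <= M} }.

(** A product of two L^2 functions is integrable by Hoelder's inequality, and
    multiplying by an essentially bounded weight enlarges the integral of the
    absolute value at most by a constant factor. *)
Lemma integrable_weight k f g : bounded_weight k ->
  f \in Lfun (mu2 R) 2%:E -> g \in Lfun (mu2 R) 2%:E ->
  (mu2 R).-integrable S (EFin \o (fun x => k x * f x * g x)).
Proof.
move=> [mk [M kM]] f2 g2.
have := (Lfun1_integrable _ _).1 (Lfun2_mul_Lfun1 f2 g2).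
move=> /(integrableS measurableT mS (@subsetT _ S)) fgS.
have mfg : measurable_fun S (f \* g) by move/measurable_int: fgS => /measurable_EFinP.
have mkfg : measurable_fun S (fun x => k x * f x * g x).
  rewrite (_ : (fun x => _) = k \* (f \* g)); first exact: measurable_funM.
  by apply/funext => x /=; rewrite mulrA.
have /integrableP[mMfg Mfg] := integrableZl mS M fgS.
apply/integrableP; split; first exact/measurable_EFinP.
apply: le_lt_trans Mfg; apply: ae_ge0_le_integral => //.
- by apply: measurableT_comp => //; exact/measurable_EFinP.
- exact: measurableT_comp.
apply: filterS kM => x /[apply] /andP[k0 kM].
rewrite /= -mulrA lee_fin normrM [leRHS]normrM ler_wpM2r//.
by rewrite !ger0_norm// (le_trans k0).
Qed.

Lemma form_sC k f g : form_s k S f g = form_s k S g f.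
Proof. by apply: eq_Rintegral => x _; rewrite mulrAC. Qed.

Lemma form_s_lin k r f g h : bounded_weight k -> f \in Lfun (mu2 R) 2%:E ->
  g \in Lfun (mu2 R) 2%:E -> h \in Lfun (mu2 R) 2%:E ->
  form_s k S (r *: f + g) h = r * form_s k S f h + form_s k S g h.
Proof.
move=> kb f2 g2 h2; have fh := integrable_weight kb f2 h2.
have gh := integrable_weight kb g2 h2.
have rfh : (mu2 R).-integrable S (EFin \o (fun x => r * (k x * f x * h x))).
  by have := integrableZl mS r fh; apply: eq_integrable => // x _; rewrite /= EFinM.
rewrite /form_s -RintegralZl// -RintegralD//.
apply: eq_Rintegral => x _; rewrite !fctE /= [r *: _]/(r * f x).
by rewrite mulrDr mulrDl; congr (_ + _); rewrite mulrCA !mulrA.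
Qed.

(** The integrand is nonnegative only almost everywhere, hence is first replaced
    by its absolute value. *)
Lemma form_s_ge0 k f : bounded_weight k -> f \in Lfun (mu2 R) 2%:E ->
  0 <= form_s k S f f.
Proof.
move=> kb f2; have /measurable_int mkff := integrable_weight kb f2 f2.
rewrite /form_s /Rintegral.
rewrite (ae_eq_integral (fun x => `| (k x * f x * f x)%:E |%E))//.
- by rewrite fine_ge0// integral_ge0.
- exact: measurableT_comp.
case: (weight_bound kb) => M; apply: filterS => x /[apply] /andP[k0 _].
by rewrite gee0_abs// lee_fin -mulrA mulr_ge0// -expr2 sqr_ge0.
Qed.

(** The elements of H^1_0 enter the energy argument only through the square
    integrability of their three components, which has the advantage of being
    visibly a linear condition. *)
Definition L2_triple : set (h1 R) := [set u |
  [/\ u.1 \in Lfun (mu2 R) 2%:E, u.2.1 \in Lfun (mu2 R) 2%:E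
    & u.2.2 \in Lfun (mu2 R) 2%:E]].

Lemma L2_triple_lin r (u v : h1 R) :
  L2_triple u -> L2_triple v -> L2_triple (r *: u + v).
Proof.
have [_ Lfun2_lin] := Lfun_submod_closed (mu2 R) (lee1n 2).
by move=> [u0 u1 u2] [v0 v1 v2]; split;
  [exact: Lfun2_lin r _ _ u0 v0|exact: Lfun2_lin r _ _ u1 v1|exact: Lfun2_lin r _ _ u2 v2].
Qed.

Lemma L2_tripleB (u v : h1 R) : L2_triple u -> L2_triple v -> L2_triple (u - v).
Proof. exact: (subspaceB (V := h1 R) L2_triple_lin). Qed.

Lemma L2_tripleZ r (u : h1 R) : L2_triple u -> L2_triple (r *: u).
Proof. exact: (subspaceZ (V := h1 R) L2_triple_lin). Qed.

Lemma form_c_bilinear k : bounded_weight (fun x => (k x)^-1) ->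
  symmetric_bilinear_on L2_triple (form_c k S).
Proof.
move=> kb; split=> [u v _ _|r u v w [u0 _ _] [v0 _ _] [w0 _ _]].
  exact: form_sC.
exact: form_s_lin kb _ _ _.
Qed.

Lemma bounded_weight1 : bounded_weight (cst 1).
Proof.
by split; [exact: measurable_cst|exists 1; apply: nearW => x _; rewrite ler01 lexx].
Qed.

Lemma form_L2E (u v : h1 R) : form_L2 S u v = form_s (cst 1) S u.1 v.1.
Proof. by apply: eq_Rintegral => x _; rewrite mul1r. Qed.

Lemma form_L2_bilinear : symmetric_bilinear_on L2_triple (form_L2 S).
Proof.
split=> [u v _ _|r u v w [u0 _ _] [v0 _ _] [w0 _ _]]; rewrite !form_L2E.
  exact: form_sC.
exact: form_s_lin bounded_weight1 _ _ _.
Qed.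

Lemma form_aE k (u v : h1 R) : bounded_weight k -> L2_triple u -> L2_triple v ->
  form_a k S u v = form_s k S u.2.1 v.2.1 + form_s k S u.2.2 v.2.2.
Proof.
move=> kb [_ u1 u2] [_ v1 v2]; rewrite /form_s -RintegralD//;
  [|exact: integrable_weight..].
by apply: eq_Rintegral => x _; rewrite mulrDr !mulrA.
Qed.

Lemma form_a_bilinear k : bounded_weight k ->
  symmetric_bilinear_on L2_triple (form_a k S).
Proof.
move=> kb; split=> [u v _ _|r u v w Pu Pv Pw].
  by apply: eq_Rintegral => x _; rewrite /grad_dot [u.2.1 x * _]mulrC [u.2.2 x * _]mulrC.
have Puv := L2_triple_lin r Pu Pv.
rewrite (form_aE kb Puv Pw) (form_aE kb Pu Pw) (form_aE kb Pv Pw).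
case: Pu Pv Pw => [_ u1 u2] [_ v1 v2] [_ w1 w2].
have lin1 : form_s k S (r *: u + v).2.1 w.2.1 =
    r * form_s k S u.2.1 w.2.1 + form_s k S v.2.1 w.2.1 := form_s_lin r kb u1 v1 w1.
have lin2 : form_s k S (r *: u + v).2.2 w.2.2 =
    r * form_s k S u.2.2 w.2.2 + form_s k S v.2.2 w.2.2 := form_s_lin r kb u2 v2 w2.
by rewrite lin1 lin2 mulrDr addrACA.
Qed.

End WeightedForms.

(** * The coefficient and the energy of the scheme *)

(** Measurability passes to slices and to inverses; positivity and the upper
    bound for the inverse come from the lower bound for the coefficient. *)
Lemma weight_coef (R : realType) (Omega : set (pt R)) (d1 d2 z : R)
    (c : R -> pt R -> R) :
  open Omega -> admissible_coef Omega d1 d2 c -> z \in `[d1, d2] ->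
  bounded_weight Omega (c z) /\ bounded_weight Omega (fun x => (c z x)^-1).
Proof.
move=> oO cadm zD; have mc := measurable_coef_section oO cadm zD.
have [c0 c0_gt0 /(_ z zD) c_bnd] := coef_bounds cadm.
split; split => //.
- exists (c_max Omega d1 d2 c); apply: filterS c_bnd => x /[apply] /andP[c0c ->].
  by rewrite andbT (le_trans (ltW c0_gt0)).
- by apply: measurableT_comp mc; exact: measurable_inv.
exists c0^-1; apply: filterS c_bnd => x /[apply] /andP[c0c _].
have c_gt0 := lt_le_trans c0_gt0 c0c.
by rewrite invr_ge0 ltW//= lef_pV2 ?posrE.
Qed.

Lemma depth_in_range (R : realFieldType) (d1 d2 : R) (K k : nat) :
  d1 < d2 -> (0 < K)%N -> (k <= K)%N ->
  d1 + k%:R * ((d2 - d1) / K%:R) \in `[d1, d2].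
Proof.
move=> d12 K_gt0 kK; have K0 : 0 < K%:R :> R by rewrite ltr0n.
have dz_ge0 : 0 <= (d2 - d1) / K%:R by rewrite divr_ge0 ?subr_ge0 ?ltW.
rewrite in_itv/= lerDl mulr_ge0//= -lerBrDl.
have {2}-> : d2 - d1 = K%:R * ((d2 - d1) / K%:R) by rewrite mulrC divfK ?gt_eqF.
by rewrite ler_wpM2r ?ler_nat.
Qed.

Lemma sqr_norm_L2 (R : realType) (S : set (pt R)) (u : h1 R) :
  norm_L2 S u ^+ 2 = form_L2 S u u.
Proof.
by rewrite sqr_sqrtr// Rintegral_ge0 // => x _; rewrite -expr2 sqr_ge0.
Qed.

Lemma H10_L2_triple (R : realType) (U : set (pt R)) : H10 U `<=` L2_triple.
Proof. by move=> u []. Qed.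

(** The squared norm is the form itself only because the form is nonnegative,
    the square root of a negative number being 0. *)
Lemma energyE (R : realType) (S : set (pt R)) (mS : measurable S)
    (k : pt R -> R) (dt : R) (v : nat -> h1 R) (n : nat) :
  L2_triple (v n) -> L2_triple (v n.+1) ->
  bounded_weight S (fun x => (k x)^-1) ->
  energy S k dt v n =
    form_c k S (dt^-1 *: (v n.+1 - v n)) (dt^-1 *: (v n.+1 - v n))
    + 2^-1 * form_a k S (v n.+1) (v n).
Proof.
move=> v0 v1 kb; rewrite /energy /norm_c sqr_sqrtr//.
have [u2 _ _] := L2_tripleZ dt^-1 (L2_tripleB v1 v0).
exact: form_s_ge0 kb u2.
Qed.

Unset Implicit Arguments.

Theorem lemma3p2 (R : realType) (Omega : set (pt R))
  (Omega_open : open Omega) (Omega_conn : connected Omega)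
  (Omega_nonempty : Omega !=set0) (Omega_bounded : bounded_set Omega)
  (d1 d2 T : R) (d1_lt_d2 : d1 < d2) (T_gt0 : 0 < T)
  (c : R -> pt R -> R) (c_adm : admissible_coef Omega d1 d2 c)
  (K N : nat) (K_gt0 : (0 < K)%N) (N_gt0 : (0 < N)%N)
  (G : coarse_grid Omega) (m l : nat) (VCEM VPOD : set (h1 R)) :
  let dz : R := (d2 - d1) / K%:R in
  let dt : R := T / N%:R in
  let tau : R := dt * dz in
  let ck (k : nat) : pt R -> R := c (d1 + k%:R * dz) in
  let H : R := mesh_size G in
  is_CEM_space G K ck m VCEM ->
  is_POD_space Omega VCEM T K ck dz l VPOD ->
  forall (Cinv : R) (Cinv_gt0 : 0 < Cinv)
    (inverse_ineq : forall (k : nat) (u : h1 R), (k <= K)%N -> VCEM u ->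
       norm_a (ck k) Omega u <= Cinv * H^-1 * norm_L2 Omega u)
    (v : nat -> nat -> h1 R)
    (v_in : forall k n : nat, (k <= K)%N -> (n <= N.+1)%N -> VPOD (v k n))
    (scheme : forall (k n : nat) (w : h1 R),
       (1 <= k <= K)%N -> (1 <= n <= N)%N -> VPOD w ->
       form_c (ck k) Omega
         ((dt ^+ 2)^-1 *: (v k n.+1 - 2 *: v k n + v k n.-1)) w
       + form_L2 Omega ((2 * tau)^-1 *: (v k n.+1 - v k n.-1)) w
       + 2^-1 * form_a (ck k) Omega (v k n) w
       = form_L2 Omega ((2 * tau)^-1 *: (v k.-1 n.+1 - v k.-1 n.-1)) w)
    (delta : R) (delta_gt0 : 0 < delta)
    (CFL : (c_max Omega d1 d2 c)^-1 - 4^-1 * Cinv ^+ 2 * H ^- 2 * dt ^+ 2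
           >= delta),
  (4 * tau)^-1 * \sum_(1 <= n < N.+1) norm_L2 Omega (v K n.+1 - v K n.-1) ^+ 2
    + \sum_(1 <= k < K.+1) energy Omega (ck k) dt (v k) N
  <= (4 * tau)^-1 * \sum_(1 <= n < N.+1) norm_L2 Omega (v 0%N n.+1 - v 0%N n.-1) ^+ 2
    + \sum_(1 <= k < K.+1) energy Omega (ck k) dt (v k) 0.
Proof.
move=> dz dt tau ck H _ POD Cinv _ _ v v_in scheme delta _ _.
have dz_gt0 : 0 < dz by rewrite divr_gt0 ?subr_gt0 ?ltr0n.
have dt_gt0 : 0 < dt by rewrite divr_gt0 ?ltr0n.
have tau_gt0 : 0 < tau by rewrite mulr_gt0.
have mO := open_measurable_plane Omega_open.
have weight k (kK : (k <= K)%N) : bounded_weight Omega (ck k) /\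
    bounded_weight Omega (fun x => (ck k x)^-1).
  exact: weight_coef Omega_open c_adm (depth_in_range d1_lt_d2 K_gt0 kK).
have v_L2 k n : (k <= K)%N -> (n <= N.+1)%N -> L2_triple (v k n).
  move=> kK nN; have := v_in k n kK nN.
  by case: POD => [? [? [? [? [? [? [_ _ _ ->]]]]]]] [/H10_L2_triple].
apply: (telescope_energy_flux
  (E := fun k n => energy Omega (ck k) dt (v k) n)
  (A := fun k n => norm_L2 Omega (v k n.+1 - v k n.-1) ^+ 2)).
move=> k n kK nN; cbv beta; have [wk wVk] := weight k.+1 kK.
have [nN1 nN2] := (ltnW nN, leqW (ltnW nN)).
have v0 : L2_triple (v k.+1 n) by exact: v_L2.
have v1 : L2_triple (v k.+1 n.+1) by exact: v_L2.
have v2 : L2_triple (v k.+1 n.+2) by exact: v_L2.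
have q0 : L2_triple (v k n) by apply: v_L2 nN2; exact: ltnW.
have q2 : L2_triple (v k n.+2) by apply: v_L2 => //; exact: ltnW.
rewrite (energyE mO dt v1 v2 wVk) (energyE mO dt v0 v1 wVk).
rewrite (sqr_norm_L2 Omega (v k.+1 n.+2 - v k.+1 n.+1.-1)).
rewrite (sqr_norm_L2 Omega (v k n.+2 - v k n.+1.-1)).
have b_ge0 u : L2_triple u -> 0 <= form_L2 Omega u u.
  by move=> _; rewrite -sqr_norm_L2 sqr_ge0.
apply: (leapfrog_energy_step (V := h1 R) L2_triple_lin (form_c_bilinear mO wVk)
  (form_L2_bilinear mO) (form_a_bilinear mO wk) b_ge0 tau_gt0 v0 v1 v2 q0 q2).
move=> w w_in; apply: (scheme k.+1 n.+1) => //.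
by move: w_in; rewrite !inE => /orP[] /eqP ->; apply: v_in.
Qed.
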